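(* Let $P\subset\mathbb{R}^{d_1}$ be a polytope with vertices $v_1,\dots,v_n$, let $Q_1,\dots,Q_n\subset\mathbb{R}^{d_2}$ be polytopes, and define $$P[Q_1,\dots,Q_n]=\mathrm{conv}\left(\bigcup_{i=1}^n\{v_i\}\times Q_i\right)\subset\mathbb{R}^{d_1+d_2}.$$ If $P$ is covering and $Q_1,\dots,Q_n$ are such that every Minkowski convex combination $$\lambda_1Q_1+\cdots+\lambda_nQ_n,\qquad \lambda_i\in[0,1],\ \sum_{i=1}^n\lambda_i=1,$$ is covering, then $P[Q_1,\dots,Q_n]$ is covering.
   Context: A convex body $K\subset\mathbb{R}^d$ (non-empty compact convex set) is covering if $K+\mathbb{Z}^d=\mathbb{R}^d$ (with $d$ the dimension of the ambient space, so here $d=d_1$, $d_2$ or $d_1+d_2$). *)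

(* Defs.v *)
From mathcomp Require Import all_boot all_order all_algebra.
From mathcomp Require Import all_classical all_reals all_analysis.

Set Implicit Arguments.
Unset Strict Implicit.
Unset Printing Implicit Defensive.

Import Order.TTheory GRing.Theory Num.Theory.
Import numFieldNormedType.Exports.

Local Open Scope classical_set_scope.
Local Open Scope ring_scope.

Definition conv_hull (R : realType) (d : nat) (A : set 'rV[R]_d) :
    set 'rV[R]_d :=
  smallest (@convex_set R 'rV[R]_d) A.

(* The empty set counts as a polytope here; the nonemptiness required of a
   convex body is part of [convex_body], hence of [covering]. *)
Definition polytope (R : realType) (d : nat) (P : set 'rV[R]_d) : Prop :=
  exists2 A : set 'rV[R]_d, finite_set A & P = conv_hull A.

(* Extreme points; for a polytope these are its 0-dimensional faces. *)
Definition vertices (R : realType) (d : nat) (P : set 'rV[R]_d) :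
    set 'rV[R]_d :=
  [set x | P x /\ forall (y z : 'rV[R]_d) (t : R), P y -> P z -> 0 < t < 1 ->
     x = t *: y + (1 - t) *: z -> y = x /\ z = x].

Definition convex_body (R : realType) (d : nat) (K : set 'rV[R]_d) : Prop :=
  [/\ K !=set0, compact K & convex_set K].

Definition int_lattice (R : realType) (d : nat) : set 'rV[R]_d :=
  [set z | forall i, z ord0 i \is a Num.int].
Arguments int_lattice : clear implicits.

Definition minkowski_sum (R : realType) (d : nat) (A B : set 'rV[R]_d) :
    set 'rV[R]_d :=
  [set a + b | a in A & b in B].

Definition covering (R : realType) (d : nat) (K : set 'rV[R]_d) : Prop :=
  convex_body K /\ minkowski_sum K (int_lattice R d) = setT.

Definition minkowski_comb (R : realType) (d n : nat) (l : 'I_n -> R)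
    (Q : 'I_n -> set 'rV[R]_d) : set 'rV[R]_d :=
  [set \sum_(i < n) l i *: q i | q in [set q : 'I_n -> 'rV[R]_d |
     forall i, Q i (q i)]].

(* With [v] enumerating the vertices of P, this is P[Q_1, ..., Q_n]; R^d1 x R^d2
   is identified with R^(d1 + d2) by concatenation of coordinates. *)
Definition polytope_subst (R : realType) (d1 d2 n : nat) (v : 'I_n -> 'rV[R]_d1)
    (Q : 'I_n -> set 'rV[R]_d2) : set 'rV[R]_(d1 + d2) :=
  conv_hull (\bigcup_(i in [set: 'I_n]) [set row_mx (v i) y | y in Q i]).

(* Main.v *)
Require Import Defs.
From mathcomp Require Import all_boot all_order all_algebra.
From mathcomp Require Import all_classical all_reals all_analysis.
From mathcomp Require Import ring lra.

Import Order.TTheory GRing.Theory Num.Theory.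
Import numFieldNormedType.Exports.

Local Open Scope classical_set_scope.
Local Open Scope ring_scope.

(* Given (x, y), write x = p + z with z integral and p = sum_i l_i v_i, which is
   possible since a polytope is the convex hull of its vertices. For these
   weights, y = sum_i l_i q_i + w with q_i in Q_i and w integral, whence
   (x, y) = sum_i l_i (v_i, q_i) + (z, w). *)

Section ConvexHull.
Set Implicit Arguments.
Unset Strict Implicit.
Context {R : realType} {d : nat}.
Implicit Types (A B : set 'rV[R]_d) (a b x y : 'rV[R]_d).

(** Trades the bundled interval weights and [\in] memberships of [convex_set] for a real [t] with
    explicit bounds, a form in which [lra] and [nra] can treat the weights. *)
Lemma convex_setE A : @convex_set R 'rV[R]_d A <->
  forall x y (t : R), A x -> A y -> 0 <= t <= 1 -> A (t *: x + (1 - t) *: y).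
Proof.
split=> [cA x y t Ax Ay t01|cA x y t]; last first.
  rewrite !inE => Ax Ay; apply: (cA x y t%:num Ax Ay).
  by rewrite ge0 le1.
have := cA x y (Itv01 (andP t01).1 (andP t01).2).
by rewrite !inE; apply.
Qed.

(** Keeping the total weight as a factor, rather than dividing by it, lets weighted points be merged
    even when both weights vanish. *)
Lemma convex_comb2 A (c c' : R) x y : @convex_set R 'rV[R]_d A ->
  0 <= c -> 0 <= c' -> A x -> A y ->
  exists2 z, A z & c *: x + c' *: y = (c + c') *: z.
Proof.
move=> /convex_setE cA c0 c'0 Ax Ay.
have [cc'0|cc'N0] := eqVneq (c + c') 0.
  have -> : c = 0 by lra.
  have -> : c' = 0 by lra.
  by exists x => //; rewrite !scale0r !addr0 scale0r.
exists ((c / (c + c')) *: x + (1 - c / (c + c')) *: y).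
  apply: cA => //; rewrite divr_ge0 ?addr_ge0//=.
  by rewrite ler_pdivrMr ?mul1r ?lerDl// lt_def cc'N0 addr_ge0.
by rewrite scalerDr !scalerA; congr (_ *: _ + _ *: _); field.
Qed.

Lemma convex_sum A n (l : 'I_n -> R) (x : 'I_n -> 'rV[R]_d) :
  @convex_set R 'rV[R]_d A -> (forall i, 0 <= l i) -> \sum_(i < n) l i = 1 ->
  (forall i, A (x i)) -> A (\sum_(i < n) l i *: x i).
Proof.
move=> cA l0 l1 Ax.
have A0 : A !=set0.
  case: n l x l0 l1 Ax => [l x _|n l x _ _ Ax]; last by exists (x ord0).
  by rewrite big_ord0 => /eqP; rewrite eq_sym oner_eq0.
have [_ [y Ay]] : 0 <= \sum_(i < n) l i /\
    exists2 y, A y & \sum_(i < n) l i *: x i = (\sum_(i < n) l i) *: y.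
  (* Partial sums have total weight below 1 in general, so the invariant is homogeneous: each is its
     total weight times a point of [A]. For the empty sum any point serves, whence [A0]. *)
  apply: (big_ind2 (fun u (c : R) => 0 <= c /\ exists2 y, A y & u = c *: y)).
  - by split=> //; case: A0 => y Ay; exists y => //; rewrite scale0r.
  - move=> _ c _ c' [c0 [y Ay ->]] [c'0 [y' Ay' ->]].
    split; first exact: addr_ge0.
    exact: convex_comb2.
  - by move=> i _; split=> //; exists (x i).
by rewrite l1 scale1r => ->.
Qed.

Lemma conv_hull_convex A : @convex_set R 'rV[R]_d (conv_hull A).
Proof.
apply/convex_setE => x y t Ax Ay t01 B cAB.
by apply: ((convex_setE B).1 cAB.1) => //; [exact: Ax|exact: Ay].
Qed.

Lemma sub_conv_hull A : A `<=` conv_hull A.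
Proof. exact: sub_gen_smallest. Qed.

Lemma conv_hull_sub A B : @convex_set R 'rV[R]_d B -> A `<=` B ->
  conv_hull A `<=` B.
Proof. exact: smallest_sub. Qed.

Lemma conv_hullS A B : A `<=` B -> conv_hull A `<=` conv_hull B.
Proof.
move=> AB; apply: conv_hull_sub; first exact: conv_hull_convex.
exact: subset_trans AB (@sub_conv_hull B).
Qed.

Lemma conv_hull1 a : conv_hull [set a] = [set a].
Proof.
apply: smallest_id; apply/convex_setE => x y t -> -> _ /=.
by rewrite -scalerDl addrC subrK scale1r.
Qed.

(** The union of the segments from [a] to the hull of [A] is already convex. If [A] were empty there
    would be no segment, and [a] itself would be missed. *)
Lemma conv_hullU1 a A : A !=set0 -> conv_hull (a |` A) =
  [set x | exists (t : R) y,
    [/\ 0 <= t <= 1, conv_hull A y & x = t *: a + (1 - t) *: y]].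
Proof.
move=> [a0 Aa0]; apply/seteqP; split; last first.
  move=> x [t [y [t01 Ay ->]]].
  apply: (convex_setE _).1 => //; first exact: conv_hull_convex.
    by apply: sub_conv_hull; left.
  by apply: conv_hullS Ay => z; right.
apply: conv_hull_sub; last first.
  move=> x [->|Ax].
    exists 1, a0; split; [lra|exact: sub_conv_hull|].
    by rewrite scale1r subrr scale0r addr0.
  exists 0, x; split; [lra|exact: sub_conv_hull|].
  by rewrite scale0r subr0 scale1r add0r.
apply/convex_setE => _ _ t [s [y [s01 Ay ->]]] [s' [y' [s'01 Ay' ->]]] t01.
have [||z Az zE] := @convex_comb2 _ (t * (1 - s)) ((1 - t) * (1 - s')) _ _
  (@conv_hull_convex A) _ _ Ay Ay'.
- by apply: mulr_ge0; lra.
- by apply: mulr_ge0; lra.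
(* The coefficients of [a] add up to the new parameter; the complementary weight is the total of the
   two weights merged into [z]. *)
exists (t * s + (1 - t) * s'), z; split=> //; first nra.
rewrite (_ : 1 - (t * s + _) = t * (1 - s) + (1 - t) * (1 - s')); last by ring.
rewrite -zE !scalerDr !scalerA [in RHS]scalerDl.
by rewrite addrACA.
Qed.

(** If [b] lies strictly between [y] and [z], expanding both along segments from [b] to the hull of
    [B] and cancelling the multiples of [b] leaves [c *: b = c *: w] with [w] in that hull. Hence
    [c = 0], which forces [y = z = b]. *)
Lemma conv_hull_vertex b B : ~ conv_hull B b -> vertices (conv_hull (b |` B)) b.
Proof.
move=> nBb; split; first by apply: sub_conv_hull; left.
have [->|/set0P B0] := eqVneq B set0.
  by move=> y z t; rewrite setU0 conv_hull1 => -> ->.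
move=> y z t; rewrite conv_hullU1//.
move=> [s [y' [s01 By' yE]]] [s' [z' [s'01 Bz' zE]]] t01 bE.
have [||w Bw wE] := @convex_comb2 _ (t * (1 - s)) ((1 - t) * (1 - s')) _ _
  (@conv_hull_convex B) _ _ By' Bz'.
- by apply: mulr_ge0; lra.
- by apply: mulr_ge0; lra.
(* [b] is [r] times itself plus [1 - r] times a point of the hull of [B]. *)
set c := _ + (1 - t) * (1 - s') in wE.
have cb : c *: b = c *: w.
  rewrite -wE (_ : c = 1 - (t * s + (1 - t) * s')); last by rewrite /c; ring.
  rewrite [LHS]scalerBl scale1r {1}bE yE zE !scalerDr !scalerA.
  by rewrite [X in _ - X]scalerDl addrACA [LHS]addrAC subrr add0r.
have [c0|cN0] := eqVneq c 0; last first.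
  by case: nBb; rewrite (scalerI cN0 cb).
(* The two nonnegative summands of [c] both vanish; as [t] and [1 - t] are positive, [s] and [s']
   must be 1. *)
have u0 : 0 <= t * (1 - s) by apply: mulr_ge0; lra.
have v0 : 0 <= (1 - t) * (1 - s') by apply: mulr_ge0; lra.
have s1 : s = 1.
  have /eqP : t * (1 - s) = 0 by rewrite /c in c0; lra.
  by rewrite mulf_eq0 => /orP[/eqP|/eqP]; lra.
have s'1 : s' = 1.
  have /eqP : (1 - t) * (1 - s') = 0 by rewrite /c in c0; lra.
  by rewrite mulf_eq0 => /orP[/eqP|/eqP]; lra.
by rewrite yE zE s1 s'1 !scale1r subrr !scale0r !addr0.
Qed.

(** A generator that is not a vertex lies in the hull of the others, by [conv_hull_vertex], so it
    can be discarded without changing the hull. Finitely many removals leave only vertices. *)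
Lemma conv_hull_vertices A : finite_set A ->
  conv_hull (vertices (conv_hull A)) = conv_hull A.
Proof.
move=> finA; apply/seteqP; split.
  by apply: conv_hull_sub => [|x []//]; exact: conv_hull_convex.
have /finite_seqP[s] := finA.
(* The induction is on a bound for the size, since filtering out a point may delete several copies
   of it. *)
elim: {s}(size s) {-2}s (leqnn (size s)) A {finA} => [|n IHn] s sn A ->{A}.
  case: s sn => // _; apply: conv_hullS => x; by rewrite /= in_nil.
have [sV|] := pselect ([set` s] `<=` vertices (conv_hull [set` s])).
  exact: conv_hullS.
move=> /existsNP[b /not_implyP[/= bs nVb]].
pose s' := [seq x <- s | x != b].
have sE : [set` s] = b |` [set` s'].
  apply/seteqP; split=> x /=; rewrite mem_filter.
    by have [->|] := eqVneq x b; [left|right].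
  by case=> [->//|/andP[]].
have s'b : conv_hull [set` s'] b.
  by apply: contrapT => /conv_hull_vertex; rewrite -sE.
have -> : conv_hull [set` s] = conv_hull [set` s'].
  apply/seteqP; split; last by rewrite sE; apply: conv_hullS => x; right.
  rewrite sE; apply: conv_hull_sub; first exact: conv_hull_convex.
  by move=> x [->//|]; exact: sub_conv_hull.
apply: (IHn s') => //; rewrite -ltnS (leq_trans _ sn)// size_filter.
rewrite -(count_predC (pred1 b) s) -[X in (X < _)%N]add0n ltn_add2r.
by rewrite -has_count has_pred1.
Qed.

(** Adding one generator [a] to a nonempty list replaces the hull by a continuous image of its
    product with the unit interval, by [conv_hullU1]. *)
Lemma conv_hull_compact A : finite_set A -> compact (conv_hull A).
Proof.
move=> /finite_seqP[s ->{A}]; elim: s => [|a s IHs].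
  rewrite (_ : conv_hull _ = set0); first exact: compact0.
  apply/seteqP; split=> //; apply: conv_hull_sub; first by apply/convex_setE.
  by move=> x; rewrite /= in_nil.
rewrite (_ : [set` a :: s] = a |` [set` s]); last first.
  apply/seteqP; split=> x /=; rewrite in_cons.
    by case/orP=> [/eqP|]; [left|right].
  by case=> [->|->]; rewrite ?eqxx ?orbT.
have [->|/set0P s0] := eqVneq [set` s] set0.
  rewrite setU0 conv_hull1; exact: compact_set1.
rewrite conv_hullU1//.
pose f (u : R * 'rV[R]_d) : 'rV[R]_d := u.1 *: a + (1 - u.1) *: u.2.
rewrite (_ : [set _ | _] = f @` ([set` `[0, 1]] `*` conv_hull [set` s])); last first.
  apply/seteqP; split=> [x [t [y [t01 sy ->]]]|_ [[t y] /= [t01 sy] <-]].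
    by exists (t, y) => //; split=> //=; rewrite in_itv.
  by exists t, y; split=> //; rewrite in_itv in t01.
apply: continuous_compact.
  apply: continuous_subspaceT => u.
  apply: cvgD; first by apply: cvgZr_tmp; exact: cvg_fst.
  apply: cvgZ; last exact: cvg_snd.
  by apply: cvgB; [exact: cvg_cst|exact: cvg_fst].
by apply: compact_setX => //; exact: segment_compact.
Qed.

(** Such combinations form a convex set that contains each [v i], through indicator weights, and
    therefore the whole hull. *)
Lemma conv_hull_range n (v : 'I_n -> 'rV[R]_d) x : conv_hull (range v) x ->
  exists l : 'I_n -> R, [/\ forall i, 0 <= l i, \sum_(i < n) l i = 1 &
    x = \sum_(i < n) l i *: v i].
Proof.
move: x; apply: conv_hull_sub.
  apply/convex_setE => _ _ t [l [l0 l1 ->]] [l' [l'0 l'1 ->]] /andP[t0 t1].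
  exists (fun i => t * l i + (1 - t) * l' i); split.
  - by move=> i; rewrite addr_ge0 ?mulr_ge0 ?subr_ge0.
  - by rewrite big_split/= -!mulr_sumr l1 l'1; ring.
  - rewrite !scaler_sumr -big_split/=; apply: eq_bigr => i _.
    by rewrite !scalerA -scalerDl.
move=> _ [i _ <-]; exists (fun j => (j == i)%:R); split.
- by move=> j; exact: ler0n.
- by rewrite (bigD1 i)//= eqxx big1 ?addr0// => j /negbTE ->.
- rewrite (bigD1 i)//= eqxx scale1r big1 ?addr0// => j /negbTE ->.
  by rewrite scale0r.
Qed.

End ConvexHull.

Lemma int_lattice_row_mx (R : realType) (d1 d2 : nat) (z : 'rV[R]_d1)
    (w : 'rV[R]_d2) : int_lattice R d1 z -> int_lattice R d2 w ->
  int_lattice R (d1 + d2) (row_mx z w).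
Proof. by move=> zi wi i; rewrite mxE; case: splitP => j _. Qed.

Lemma sum_row_mx (R : realType) (d1 d2 n : nat) (l : 'I_n -> R)
    (x : 'I_n -> 'rV[R]_d1) (y : 'I_n -> 'rV[R]_d2) :
  \sum_(i < n) l i *: row_mx (x i) (y i) =
  row_mx (\sum_(i < n) l i *: x i) (\sum_(i < n) l i *: y i).
Proof.
elim/big_rec3: _ => [|i a b c _ ->]; first by rewrite row_mx0.
by rewrite scale_row_mx add_row_mx.
Qed.

(** Serves to obtain compactness. The points [row_mx (v i) y] with [y] in a finite generating set of
    [Q i] suffice as generators. *)
Lemma polytope_subst_polytope (R : realType) (d1 d2 n : nat)
    (v : 'I_n -> 'rV[R]_d1) (Q : 'I_n -> set 'rV[R]_d2) :
  (forall i, polytope (Q i)) -> polytope (polytope_subst v Q).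
Proof.
move=> polyQ.
have [A finA QA] : exists2 A : 'I_n -> set 'rV[R]_d2,
    forall i, finite_set (A i) & forall i, Q i = conv_hull (A i).
  have /choice[A AP] : forall i, exists A, finite_set A /\ Q i = conv_hull A.
    by move=> i; have [A] := polyQ i; exists A.
  by exists A => i; have [] := AP i.
exists (\bigcup_(i in [set: 'I_n]) [set row_mx (v i) y | y in A i]).
  by apply: bigcup_finite => // i _; exact: finite_image.
apply/seteqP; split; apply: conv_hull_sub; do ?exact: conv_hull_convex.
  move=> _ [i _ [y Qy <-]]; move: y Qy; rewrite QA; apply: conv_hull_sub.
    (* The slice of the hull over [v i] is convex: combining two of its points fixes the first
       block, as the weights sum to 1. *)
    apply/convex_setE => x y t /= Ax Ay t01.
    have := (convex_setE _).1 (@conv_hull_convex _ _ _) _ _ _ Ax Ay t01.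
    rewrite !scale_row_mx add_row_mx -scalerDl addrC subrK scale1r.
    exact.
  by move=> y Ay; apply: sub_conv_hull; exists i => //; exists y.
move=> _ [i _ [y Ay <-]]; apply: sub_conv_hull; exists i => //; exists y => //.
by rewrite QA; exact: sub_conv_hull.
Qed.

Theorem proposition2p9 (R : realType) (d1 d2 n : nat) (P : set 'rV[R]_d1)
    (v : 'I_n -> 'rV[R]_d1) (Q : 'I_n -> set 'rV[R]_d2)
    (polyP : polytope P)
    (v_inj : injective v) (vertP : vertices P = range v)
    (polyQ : forall i : 'I_n, polytope (Q i))
    (covP : covering P)
    (covQ : forall l : 'I_n -> R, (forall i : 'I_n, 0 <= l i <= 1) ->
       \sum_(i < n) l i = 1 -> covering (minkowski_comb l Q)) :
  covering (polytope_subst v Q).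
Proof.
have covT : minkowski_sum (polytope_subst v Q) (int_lattice R (d1 + d2)) = setT.
  apply/seteqP; split=> // u _; rewrite -[u]hsubmxK.
  move: (lsubmx u) (rsubmx u) => x y {u}.
  have [p Pp [z zi <-]] : minkowski_sum P (int_lattice R d1) x by rewrite covP.2.
  have [A finA PA] := polyP.
  have : conv_hull (range v) p by rewrite -vertP PA conv_hull_vertices// -PA.
  move=> /conv_hull_range[l [l0 l1 ->]].
  have l01 i : 0 <= l i <= 1.
    by rewrite l0 -l1 (bigD1 i)//= lerDl sumr_ge0.
  have : minkowski_sum (minkowski_comb l Q) (int_lattice R d2) y.
    by rewrite (covQ l l01 l1).2.
  move=> [_ [q Qq <-] [w wi <-]].
  exists (\sum_(i < n) l i *: row_mx (v i) (q i)).
    apply: convex_sum => //; first exact: conv_hull_convex.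
    by move=> i; apply: sub_conv_hull; exists i => //; exists (q i).
  exists (row_mx z w); first exact: int_lattice_row_mx.
  by rewrite sum_row_mx add_row_mx.
split=> //; split.
(* Any translate covering the origin exhibits a point of the body. *)
- have [a Qa _] : minkowski_sum (polytope_subst v Q) (int_lattice R (d1 + d2)) 0.
    by rewrite covT.
  by exists a.
- by have [A finA ->] := polytope_subst_polytope v polyQ; exact: conv_hull_compact.
- exact: conv_hull_convex.
Qed.
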